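(* Let $d$ be a positive integer, $\Omega=\mathbb{R}^d$, $\Theta\subseteq\mathbb{R}^d$, and let $\Pi$ have density $\pi$ with respect to Lebesgue measure on $\mathbb{R}^d$ with $s=\sup_{\theta\in\Theta}\pi(\theta)<\infty$. Let $c(\cdot,\cdot)$ be a metric cost function on $\mathbb{R}^d$ such that, for some constant $C_{0,d}$, $c(\theta,\omega)\ge C_{0,d}\|\theta-\omega\|_1$ for all $\theta,\omega\in\mathbb{R}^d$. Let $P$ be an ARB Markov kernel with invariant measure $\Pi$ and acceptance probability $A(\cdot)$, and let $p$ be a positive integer. If $$C_{d,\pi}=C_{0,d}\,d\left[2s^{\frac1d}(1+d)^{1+\frac1d}\right]^{-1},$$ then for every positive integer $t$ and every $\theta\in\mathbb{R}^d$, $$\mathcal{W}_c^p(P^t(\theta,\cdot),\Pi)\ \ge\ C_{d,\pi}[1-A(\theta)]^{t\left(1+\frac1d\right)}.$$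
   Context: $\Pi$ is a probability measure on $(\Omega,\mathcal{B}(\Omega))$, $\Omega=\mathbb{R}^d$, supported on a nonempty measurable set $\Theta\subseteq\mathbb{R}^d$; the support of $\pi$ is $\Theta$, so $\pi(\theta)>0$ for each $\theta\in\Theta$. Write $\lambda$ for Lebesgue measure. ARB kernel: for each $\theta\in\Omega$, $Q(\theta,\cdot)$ is a proposal distribution on $(\Omega,\mathcal{B}(\Omega))$ with density $q(\theta,\cdot)$ with respect to $\lambda$. Given an acceptance function $a:\Omega\times\Omega\to[0,1]$, the acceptance probability is $A(\theta)=\int a(\theta,\theta')q(\theta,\theta')\,d\lambda(\theta')$, and the ARB Markov kernel is $$P(\theta,B)=\int_B a(\theta,\theta')q(\theta,\theta')\,d\lambda(\theta')+\delta_\theta(B)[1-A(\theta)],\qquad \theta\in\Omega,\ B\in\mathcal{B}(\Omega),$$ where $\delta_\theta$ is the Dirac measure at $\theta$. It is assumed that $a$ is such that $\Pi$ is invariant for $P$ (reversibility is not assumed). $P^t$ denotes the $t$-step kernel, $P^1=P$. Wasserstein distance of order $p$: for probability measures $\mu,\nu$, $\mathcal{W}_c^p(\mu,\nu)=\left(\inf_{\Gamma\in\mathcal{C}(\mu,\nu)}\int c(\theta,\omega)^p\,d\Gamma(\theta,\omega)\right)^{1/p}\in[0,\infty]$, where $\mathcal{C}(\mu,\nu)$ is the set of joint probability measures with marginals $\mu,\nu$ (the superscript $p$ denotes the order, not a power; $c$ is such that the integrals are defined). $\|\cdot\|_1$ is the 1-norm on $\mathbb{R}^d$. *)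

(* Defs.v *)
From HB Require Import structures.
From mathcomp Require Import all_boot all_order all_algebra.
From mathcomp Require Import all_classical all_reals all_analysis.

Set Implicit Arguments.
Unset Strict Implicit.
Unset Printing Implicit Defensive.

Import Order.TTheory GRing.Theory Num.Theory.
Import numFieldNormedType.Exports.

Local Open Scope classical_set_scope.
Local Open Scope ring_scope.

(* R^d is represented by the type d.-tuple R, whose library sigma-algebra is
   the one generated by the coordinate maps into R with its Borel sets, that
   is, the Borel sigma-algebra of R^d. *)

Section lebesgue_tuple.
Context {R : realType}.
Local Open Scope ereal_scope.

Definition tuple_of_pair n (xv : measurableTypeR R * n.-tuple R) :
  n.+1.-tuple R := [tuple of xv.1 :: xv.2].

Lemma measurable_tuple_of_pair n :
  measurable_fun [set: measurableTypeR R * n.-tuple R] (@tuple_of_pair n).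
Proof. exact: measurable_cons. Qed.

Fixpoint lebesgue_tuple (n : nat) : set (n.-tuple R) -> \bar R :=
  match n with
  | 0 => \d_([tuple] : 0.-tuple R)
  | m.+1 => pushforward (lebesgue_measure \x @lebesgue_tuple m)
                        (@tuple_of_pair m)
  end.

Let pack_sigma_finite d (T : measurableType d) (P : {measure set T -> \bar R}) :
  sigma_finite setT P ->
  exists nu : {sigma_finite_measure set T -> \bar R},
    P = nu :> (set T -> \bar R).
Proof.
move=> sP.
pose H1 := isSFinite.Build _ _ _ _ (sfinite_measure_sigma_finite sP).
pose H2 := isSigmaFinite.Build _ _ _ _ sP.
by exists (HB.pack_for (SigmaFiniteMeasure.type T R)
  (Measure.sort P) H1 H2).
Qed.

Let lebesgue_tuple_step m
    (mu : {sigma_finite_measure set (m.-tuple R) -> \bar R}) :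
  exists nu : {sigma_finite_measure set (m.+1.-tuple R) -> \bar R},
    pushforward (lebesgue_measure \x mu) (@tuple_of_pair m)
      = nu :> (set (m.+1.-tuple R) -> \bar R).
Proof.
pose P : {measure set (m.+1.-tuple R) -> \bar R} :=
  measure_function_pushforward__canonical__measure_function_Measure
    (@lebesgue_measure R \x mu) (@measurable_tuple_of_pair m).
have sP : sigma_finite setT P.
  have [F FT Foo] : sigma_finite setT (@lebesgue_measure R \x mu).
    have /sigma_finiteP[F [TF ndF Foo]] := sigma_finiteT (@lebesgue_measure R).
    have /sigma_finiteP[G [TG ndG Goo]] := sigma_finiteT mu.
    exists (fun n => F n `*` G n).
      rewrite -setXTT TF TG predeqE => -[x y]; split.
        move=> [/= [n _ Fnx] [k _ Gky]]; exists (maxn n k) => //; split.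
        - by move: x Fnx; exact/subsetPset/ndF/leq_maxl.
        - by move: y Gky; exact/subsetPset/ndG/leq_maxr.
      by move=> [n _ []/= ? ?]; split; exists n.
    move=> k; have [? ?] := Foo k; have [? ?] := Goo k.
    split; first exact: measurableX.
    by rewrite product_measure1E// lte_mul_pinfty// ge0_fin_numE.
  pose g (v : m.+1.-tuple R) : measurableTypeR R * m.-tuple R :=
    (thead v, [tuple of behead v]).
  have gK : cancel (@tuple_of_pair m) g.
    move=> [x v]; rewrite /g /tuple_of_pair/=; congr pair.
    by apply/val_inj.
  exists (fun i => g @^-1` F i).
    by rewrite -preimage_bigcup -FT preimage_setT.
  move=> i; have [mFi Fioo] := Foo i; split.
    rewrite -[X in measurable X]setTI.
    have mg : measurable_fun setT g.
      apply/measurable_fun_pairP; split.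
        exact: measurable_tnth.
      exact: measurable_behead.
    exact: mg.
  rewrite /P/= /pushforward -comp_preimage.
  by rewrite (_ : g \o _ = id) ?preimage_id//; apply/funext => x; exact: gK.
exact: (pack_sigma_finite sP).
Qed.

Let lebesgue_tuple_sigma_finite_measure n :
  exists nu : {sigma_finite_measure set (n.-tuple R) -> \bar R},
    @lebesgue_tuple n = nu :> (set (n.-tuple R) -> \bar R).
Proof.
elim: n => [|m [nu ih]] /=; first by exists (\d_([tuple] : 0.-tuple R)).
rewrite ih; exact: lebesgue_tuple_step.
Qed.

Let lebesgue_tuple0 n : @lebesgue_tuple n set0 = 0.
Proof. by have [nu ->] := lebesgue_tuple_sigma_finite_measure n. Qed.

Let lebesgue_tuple_ge0 n A : 0 <= @lebesgue_tuple n A.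
Proof. by have [nu ->] := lebesgue_tuple_sigma_finite_measure n. Qed.

Let lebesgue_tuple_semi_sigma_additive n :
  semi_sigma_additive (@lebesgue_tuple n).
Proof.
have [nu ->] := lebesgue_tuple_sigma_finite_measure n.
exact: measure_semi_sigma_additive.
Qed.

HB.instance Definition _ n := isMeasure.Build _ _ _ (@lebesgue_tuple n)
  (lebesgue_tuple0 n) (@lebesgue_tuple_ge0 n)
  (@lebesgue_tuple_semi_sigma_additive n).

Let lebesgue_tuple_sigma_finite n : sigma_finite setT (@lebesgue_tuple n).
Proof.
have [nu ->] := lebesgue_tuple_sigma_finite_measure n; exact: sigma_finiteT.
Qed.

HB.instance Definition _ n := Measure_isSigmaFinite.Build _ _ _
  (@lebesgue_tuple n) (lebesgue_tuple_sigma_finite n).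

End lebesgue_tuple.
Arguments lebesgue_tuple {R} n _.

Lemma lebesgue_tuple_box (R : realType) n (l u : 'I_n -> R) :
  (forall i, l i <= u i) ->
  lebesgue_tuple n [set x : n.-tuple R | forall i, l i <= tnth x i <= u i] =
  (\prod_(i < n) (u i - l i))%:E.
Proof.
elim: n => [|n ih] in l u *; move=> lu.
  by rewrite big_ord0 /= diracE mem_set//= => -[].
set B := [set x | forall i, _].
pose B' := [set x : n.-tuple R |
  forall i, l (lift ord0 i) <= tnth x i <= u (lift ord0 i)].
have mB' : measurable B'.
  rewrite (_ : B' = \bigcap_(i in [set: 'I_n])
      ((@tnth _ R ^~ i) @^-1` `[l (lift ord0 i), u (lift ord0 i)])); last first.
    apply/seteqP; split => x /= xB i; last by have := xB i I; rewrite /= in_itv.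
    by move=> _ /=; rewrite in_itv/=; exact: xB.
  apply: fin_bigcap_measurable; first exact: finite_finset.
  move=> i _; rewrite -[X in measurable X]setTI.
  exact: (measurable_tnth i).
have -> : lebesgue_tuple n.+1 B = ((@lebesgue_measure R \x @lebesgue_tuple R n)
    (`[l ord0, u ord0] `*` B'))%E.
  rewrite /= /pushforward; congr (_ _); apply/seteqP; split => -[x v] /=.
    move=> xvB; split => /=; first by rewrite in_itv/=; exact: (xvB ord0).
    by move=> i; have := xvB (lift ord0 i); rewrite tnthS.
  rewrite in_itv/= => -[xlu vB] i.
  case: (unliftP ord0 i) => [j ->|->]; last by [].
  by rewrite tnthS; exact: vB.
rewrite product_measure1E//= lebesgue_measure_itv/= ih; last by move=> i; exact: lu.
rewrite big_ord_recl lte_fin; case: ltP => [_|ul]; first by [].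
by have -> : u ord0 = l ord0; [apply/eqP; rewrite eq_le ul lu|rewrite subrr mul0r mul0e].
Qed.

Section wasserstein.
Context d (T : measurableType d) (R : realType).

Definition coupling (mu nu : {measure set T -> \bar R}) :
    set (probability (T * T)%type R) :=
  [set G | forall B, measurable B ->
     G (B `*` setT) = mu B /\ G (setT `*` B) = nu B].

Definition wasserstein (c : T -> T -> R) (p : nat)
    (mu nu : {measure set T -> \bar R}) : \bar R :=
  (ereal_inf [set \int[G]_z ((c z.1 z.2) ^+ p)%:E | G in coupling mu nu]
     `^ p%:R^-1)%E.

End wasserstein.

Definition is_metric (T : Type) (R : realType) (c : T -> T -> R) : Prop :=
  [/\ forall x y, 0 <= c x y,
      forall x y, c x y = 0 <-> x = y,
      forall x y, c x y = c y x &
      forall x y z, c x z <= c x y + c y z].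

Definition dist_l1 (R : realType) n (x y : n.-tuple R) : R :=
  \sum_(i < n) `|tnth x i - tnth y i|.

Definition is_density d (T : measurableType d) (R : realType)
    (lam : {measure set T -> \bar R}) (f : T -> R) (mu : {measure set T -> \bar R}) :
    Prop :=
  [/\ measurable_fun setT f, forall x, 0 <= f x &
      forall B, measurable B -> mu B = (\int[lam]_(x in B) (f x)%:E)%E].

Section kernels.
Context d (T : measurableType d) (R : realType).

Definition invariant_measure (P : R.-pker T ~> T) (mu : {measure set T -> \bar R}) :
    Prop :=
  forall B, measurable B -> (\int[mu]_x P x B)%E = mu B.

Fixpoint kernel_iter (P : R.-pker T ~> T) (t : nat) : R.-spker T ~> T :=
  match t with
  | 0 => kdirac (@measurable_id _ T setT)
  | s.+1 => mkcomp_noparam P (kernel_iter P s)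
  end.

Lemma kernel_iter1 (P : R.-pker T ~> T) x B :
  measurable B -> kernel_iter P 1 x B = P x B.
Proof.
move=> mB; rewrite /= /mkcomp_noparam /kcomp_noparam /kdirac /=.
by under eq_integral do rewrite diracE -indicE; rewrite integral_indic// setIT.
Qed.

(* The measures compared by the Wasserstein distance have the same mass, so
   couplings exist. *)
Lemma kernel_iter_setT (P : R.-pker T ~> T) t x : kernel_iter P t x setT = 1%E.
Proof.
elim: t x => [|t ih] x; first by rewrite /= /kdirac /= diracT.
rewrite /= /mkcomp_noparam /kcomp_noparam.
by under eq_integral do rewrite ih; rewrite integral_cst// mul1e prob_kernel.
Qed.

Variables (lam : {measure set T -> \bar R}) (a q : T -> T -> R).

(* As 0 <= a <= 1 and q x is a probability density, the integral is finite and
   its real value is taken. *)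
Definition acceptance_prob (x : T) : R := \int[lam]_y (a x y * q x y).

(* Measurability in x of P x B is part of the type of probability kernels. *)
Definition ARB_kernel (P : R.-pker T ~> T) : Prop :=
  forall x B, measurable B ->
    P x B = (\int[lam]_(y in B) (a x y * q x y)%:E
             + \d_x B * (1 - acceptance_prob x)%:E)%E.

End kernels.

(* Main.v *)
Require Import Defs.
From HB Require Import structures.
From mathcomp Require Import all_boot all_order all_algebra.
From mathcomp Require Import all_classical all_reals all_analysis.
From mathcomp Require Import measurable_realfun ring.

Set Implicit Arguments.
Unset Strict Implicit.
Unset Printing Implicit Defensive.

Import Order.TTheory GRing.Theory Num.Theory.
Import numFieldNormedType.Exports.

Local Open Scope classical_set_scope.
Local Open Scope ring_scope.

(** A rejected proposal leaves the chain where it is, so the chain started at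
    [x] is still at [x] after [t] steps with probability at least
    [M = (1 - A(x))^t] ([ARB_kernel_stick], [kernel_iter_stick]).  The target,
    having a density bounded by [s], cannot follow: it gives mass at most
    [s (2h)^d] to the cube [B] of half-side [h] centred at [x].  Hence every
    coupling of the two laws gives mass at least [M - s (2h)^d] to the pairs
    whose first component is [x] and whose second one lies outside [B]
    ([coupling_escape]).  On these pairs the cost is at least [C0 h], because
    the 1-norm dominates the maximum norm.

    If [m] is that escaping mass, Markov's inequality bounds the integral of
    [c^p] below by [(C0 h)^p m], which is at least [(C0 h m)^p] since
    [m <= 1].  The [p]-th root then gives the bound [C0 h m], the same for all
    orders [p] ([le_wasserstein_escape]).

    It remains to choose [h].  The product [h (M - s (2h)^d)] is largest when
    [s (2h)^d = M / (1 + d)], and its value there is the stated bound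
    ([optimal_radius]).  If [C0] is negative, so is the constant, and the bound
    is trivial. *)

(** * Transport cost of mass forced out of a set *)

Section coupling_bounds.
Context d (T : measurableType d) (R : realType).
Local Open Scope ereal_scope.

(** A coupling can keep inside [B] at most the mass that [nu] has there, so
    the excess of [mu A] over [nu B] must be transported out of [B]. *)
Lemma coupling_escape (mu nu : {measure set T -> \bar R})
    (G : probability (T * T)%type R) (A B : set T) (m : R) :
  coupling mu nu G -> measurable A -> measurable B ->
  m%:E + nu B <= mu A -> m%:E <= G (A `*` ~` B).
Proof.
move=> cG mA mB mAB.
have mAC : measurable (A `*` ~` B) by apply: measurableX => //; exact: measurableC.
have mTB : measurable ([set: T] `*` B) by exact: measurableX.
have nuB : nu B \is a fin_num.
  by rewrite -(cG _ mB).2; exact: fin_num_measure.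
rewrite -(leeD2rE _ _ nuB) (le_trans mAB)// -(cG _ mA).1 -(cG _ mB).2.
apply: (le_trans _ (measureU2 G mAC mTB)).
apply: le_measure; rewrite ?inE//; first exact: measurableX.
  exact: measurableU.
by move=> -[y z] /= [Ay _]; have [Bz|nBz] := pselect (B z); [right|left].
Qed.

(** Markov's inequality on the escaping mass.  It yields [r * m ^ (1 / p)],
    weakened here to [r * m], which does not depend on [p]. *)
Lemma le_wasserstein_escape (c : T -> T -> R) (p : nat)
    (mu nu : {measure set T -> \bar R}) (A B : set T) (r m : R) :
  (0 < p)%N -> (forall x y, 0 <= c x y)%R ->
  measurable_fun [set: T * T] (fun z => c z.1 z.2) ->
  measurable A -> measurable B -> (0 <= r)%R -> (0 <= m)%R ->
  (forall x y, A x -> ~ B y -> r <= c x y)%R ->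
  m%:E + nu B <= mu A ->
  (r * m)%:E <= wasserstein c p mu nu.
Proof.
move=> p0 c0 mc mA mB r0 m0 rc mAB.
have pn0 : (p%:R != 0 :> R)%R by rewrite pnatr_eq0 -lt0n.
have -> : (r * m)%:E = ((r * m) ^+ p)%:E `^ p%:R^-1.
  by rewrite poweR_EFin -powR_mulrn ?mulr_ge0// -powRrM mulfV// powRr1// mulr_ge0.
have rmp : 0 <= ((r * m) ^+ p)%:E by rewrite lee_fin exprn_ge0// mulr_ge0.
have rmW : ((r * m) ^+ p)%:E <=
    ereal_inf [set \int[G]_z ((c z.1 z.2) ^+ p)%:E | G in coupling mu nu].
  apply: le_ereal_inf_tmp => _ [G cG <-].
  have mS : measurable (A `*` ~` B) by apply: measurableX => //; exact: measurableC.
  have mcp : measurable_fun [set: T * T] (fun z => c z.1 z.2 ^+ p)%R.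
    exact: measurable_funX.
  have mG := coupling_escape cG mA mB mAB.
  have m1 : (m <= 1)%R by rewrite -lee_fin (le_trans mG)// probability_le1.
  apply: (@le_trans _ _ ((r ^+ p)%:E * G (A `*` ~` B))).
    rewrite exprMn EFinM lee_wpmul2l ?lee_fin ?exprn_ge0//.
    (* [m ^+ p <= m] because [m] is at most the mass of a probability. *)
    rewrite (le_trans _ mG)// lee_fin.
    by rewrite -[leRHS]expr1 ler_wiXn2l.
  rewrite -integral_cst//.
  apply: (@le_trans _ _ (\int[G]_(z in A `*` ~` B) (c z.1 z.2 ^+ p)%:E)).
    apply: ge0_le_integral => //.
    - by move=> z _; rewrite /= lee_fin exprn_ge0.
    - by apply/measurable_EFinP; exact: measurable_funTS.
    - by move=> -[y z] /= [Ay nBz]; rewrite lee_fin lerXn2r ?nnegrE// rc.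
  apply: ge0_subset_integral => //; first exact/measurable_EFinP.
  by move=> z _; rewrite lee_fin exprn_ge0.
rewrite /wasserstein gt0_ler_poweR ?invr_ge0//; rewrite in_itv /= ?rmp ?leey//.
by rewrite (le_trans rmp)// leey.
Qed.

End coupling_bounds.

(** * Holding probability of the chain, and mass under a bounded density *)

Section sticking.
Context d (T : measurableType d) (R : realType).
Local Open Scope ereal_scope.

(** Among the paths that return to [x] at time [t] is the one that never
    moves. *)
Lemma kernel_iter_stick (P : R.-pker T ~> T) (x : T) (r : R) (t : nat) :
  measurable [set x] -> (0 <= r)%R -> r%:E <= P x [set x] ->
  (r ^+ t)%:E <= kernel_iter P t x [set x].
Proof.
move=> mx r0 rP; elim: t => [|t ih].
  by rewrite expr0 /= /kdirac /= diracE mem_set.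
rewrite /= /mkcomp_noparam /kcomp_noparam.
apply: (@le_trans _ _ (\int[P x]_(y in [set x]) kernel_iter P t y [set x])).
  rewrite (eq_integral (cst (kernel_iter P t x [set x]))); last first.
    by move=> y; rewrite inE => ->.
  rewrite integral_cst// exprSr EFinM.
  by apply: lee_pmul => //; rewrite lee_fin ?exprn_ge0.
apply: ge0_subset_integral => //.
exact: measurable_kernel.
Qed.

Variables (lam : {measure set T -> \bar R}) (a q : T -> T -> R).

(** [acceptance_prob] is the real value of an extended integral, hence the
    comparison of that integral with the mass of the proposal, which also shows
    it to be finite. *)
Lemma acceptance_prob_le1 (x : T) (Qx : probability T R) :
  is_density lam (q x) Qx -> (forall y, 0 <= a x y <= 1)%R ->
  measurable_fun [set: T] (a x) -> (acceptance_prob lam a q x <= 1)%R.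
Proof.
move=> [mq q0 Qq] a01 ma.
have I1 : \int[lam]_y (a x y * q x y)%:E <= 1.
  rewrite -(@probability_setT _ _ _ Qx) Qq//; apply: ge0_le_integral => //.
  - by move=> y _; rewrite lee_fin mulr_ge0//; case/andP: (a01 y).
  - by apply/measurable_EFinP; exact: measurable_funM.
  - by apply/measurable_EFinP.
  - by move=> y _; rewrite lee_fin ler_piMl//; case/andP: (a01 y).
rewrite /acceptance_prob /Rintegral -lee_fin fineK//.
rewrite ge0_fin_numE ?(le_lt_trans I1) ?ltry//.
by apply: integral_ge0 => y _; rewrite lee_fin mulr_ge0//; case/andP: (a01 y).
Qed.

(** Only an inequality, as the proposal itself may charge [x] when [lam]
    does. *)
Lemma ARB_kernel_stick (P : R.-pker T ~> T) (x : T) :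
  ARB_kernel lam a q P -> measurable [set x] ->
  (forall y, 0 <= a x y)%R -> (forall y, 0 <= q x y)%R ->
  (1 - acceptance_prob lam a q x)%:E <= P x [set x].
Proof.
move=> PE mx a0 q0; rewrite PE// diracE mem_set// mul1e leeDr//.
by apply: integral_ge0 => y _; rewrite lee_fin mulr_ge0.
Qed.

Lemma density_le_scale (f : T -> R) (mu : {measure set T -> \bar R}) (s : R)
    (B : set T) :
  is_density lam f mu -> (forall x, f x <= s)%R -> measurable B ->
  mu B <= s%:E * lam B.
Proof.
move=> [mf f0 muE] fs mB; rewrite muE// -integral_cst//.
apply: ge0_le_integral => //.
- by move=> y _; rewrite lee_fin.
- by apply/measurable_EFinP; exact: measurable_funTS.
- by move=> y _; rewrite lee_fin.
Qed.

End sticking.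

(** * Cubes and the 1-norm *)

Section boxes.
Context {R : realType} {n : nat}.

Lemma measurable_box (l u : 'I_n -> R) :
  measurable [set x : n.-tuple R | forall i, l i <= tnth x i <= u i].
Proof.
rewrite [X in measurable X](_ : _ = \bigcap_(i in [set: 'I_n])
    ((@tnth _ R ^~ i) @^-1` `[l i, u i])); last first.
  apply/seteqP; split => x /= xB i; last by have := xB i I; rewrite /= in_itv.
  by move=> _ /=; rewrite in_itv/=; exact: xB.
apply: fin_bigcap_measurable; first exact: finite_finset.
move=> i _; rewrite -[X in measurable X]setTI.
exact: (measurable_tnth i).
Qed.

Lemma measurable_set1_tuple (x : n.-tuple R) : measurable [set x].
Proof.
rewrite [X in measurable X](_ : _ =
    [set y : n.-tuple R | forall i, tnth x i <= tnth y i <= tnth x i]).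
  exact: measurable_box.
apply/seteqP; split => [y -> i|y xy]; first by rewrite lexx.
by apply: eq_from_tnth => i; apply/eqP; rewrite eq_le andbC xy.
Qed.

Lemma dist_l1_outside_box (x y : n.-tuple R) (h : R) :
  ~ (forall i, tnth x i - h <= tnth y i <= tnth x i + h) -> h <= dist_l1 x y.
Proof.
move=> /existsNP[i /negP]; rewrite -ler_distl -ltNge distrC => /ltW hi.
by rewrite (le_trans hi)// /dist_l1 (bigD1 i)//= lerDl sumr_ge0.
Qed.

End boxes.

(** * Choice of the cube and conclusion *)

(** The radius [h] solves [s (2h)^d = M / (1 + d)], the critical point of
    [h |-> h (M - s (2h)^d)]; the mass that escapes is then
    [M - M / (1 + d) = M d / (1 + d)].  The side of the cube is written [h + h],
    the difference of its endpoints. *)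
Lemma optimal_radius (R : realType) (d : nat) (s M C0 h : R) :
  (0 < d)%N -> 0 < s -> 0 <= M ->
  h = (M / (s * (1 + d%:R))) `^ d%:R^-1 / 2 ->
  s * (h + h) ^+ d = M / (1 + d%:R) /\
  C0 * d%:R * (2 * s `^ d%:R^-1 * (1 + d%:R) `^ (1 + d%:R^-1))^-1 *
    M `^ (1 + d%:R^-1) = C0 * h * (M * d%:R / (1 + d%:R)).
Proof.
move=> d0 s0 M0 ->.
have dR0 : 0 < d%:R :> R by rewrite ltr0n.
have d1 : 0 < 1 + d%:R :> R by rewrite addr_gt0.
have e1 (y : R) : 0 <= y -> y `^ (1 + d%:R^-1) = y * y `^ d%:R^-1.
  move=> y0; rewrite powRD ?powRr1//.
  by rewrite gt_eqF//= addr_gt0 ?invr_gt0.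
split.
  rewrite -splitr -powR_mulrn ?powR_ge0// -powRrM mulVf ?gt_eqF// powRr1.
    by field; rewrite !gt_eqF.
  by rewrite divr_ge0// mulr_ge0// ltW.
rewrite !e1 ?(ltW d1)// powRM ?invr_ge0 ?mulr_ge0 ?(ltW s0) ?(ltW d1)//.
have -> : (s * (1 + d%:R))^-1 `^ d%:R^-1 =
    (s `^ d%:R^-1 * (1 + d%:R) `^ d%:R^-1)^-1.
  rewrite -powRM ?(ltW s0) ?(ltW d1)//.
  by rewrite -powR_inv1 ?mulr_ge0 ?(ltW s0) ?(ltW d1)// -powRrM mulN1r powRN.
by field; rewrite !gt_eqF ?powR_gt0.
Qed.

Theorem theorem3 (R : realType) (d : nat) (d_gt0 : (0 < d)%N)
  (Theta : set (d.-tuple R)) (mTheta : measurable Theta)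
  (Theta_neq0 : Theta !=set0)
  (Pi : probability (d.-tuple R) R) (Pi_Theta : Pi Theta = 1%E)
  (pi_ : d.-tuple R -> R) (Pi_density : is_density (lebesgue_tuple d) pi_ Pi)
  (pi_support : Theta = [set x | pi_ x != 0])
  (s : R) (s_sup : ereal_sup [set (pi_ x)%:E | x in Theta] = s%:E)
  (c : d.-tuple R -> d.-tuple R -> R) (c_metric : is_metric c)
  (mc : measurable_fun [set: d.-tuple R * d.-tuple R] (fun z => c z.1 z.2))
  (C0 : R) (c_ge : forall x y, C0 * dist_l1 x y <= c x y)
  (Q : d.-tuple R -> probability (d.-tuple R) R)
  (q : d.-tuple R -> d.-tuple R -> R)
  (Q_density : forall x, is_density (lebesgue_tuple d) (q x) (Q x))
  (a : d.-tuple R -> d.-tuple R -> R)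
  (a_01 : forall x y, 0 <= a x y <= 1)
  (ma : forall x, measurable_fun [set: d.-tuple R] (a x))
  (P : R.-pker (d.-tuple R) ~> (d.-tuple R))
  (P_ARB : ARB_kernel (lebesgue_tuple d) a q P)
  (P_invariant : invariant_measure P Pi)
  (p : nat) (p_gt0 : (0 < p)%N) (C : R)
  (C_def : C = C0 * d%:R *
    (2 * s `^ (d%:R^-1) * (1 + d%:R) `^ (1 + d%:R^-1))^-1)
  (t : nat) (t_gt0 : (0 < t)%N) (x : d.-tuple R) :
  ((C * (1 - acceptance_prob (lebesgue_tuple d) a q x) `^ (t%:R * (1 + d%:R^-1)))%:E
   <= wasserstein c p (kernel_iter P t x) Pi)%E.
Proof.
have [/= mpi pi0 _] := Pi_density.
have [c0 _ _ _] := c_metric.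
(* [s] is a supremum over [Theta] only; outside [Theta] the density is [0],
   and [0 <= s] because [Theta] is nonempty. *)
have pi_s y : pi_ y <= s.
  have Theta_s z : Theta z -> pi_ z <= s.
    by move=> Tz; rewrite -lee_fin -s_sup; apply: ereal_sup_ubound; exists z.
  have [/eqP piy0|piy] := boolP (pi_ y == 0); last by apply: Theta_s; rewrite pi_support.
  case: Theta_neq0 => z Tz.
  by rewrite piy0 (le_trans (pi0 z))// Theta_s.
have s0 : 0 < s.
  case: Theta_neq0 => z; rewrite pi_support /= => piz.
  by rewrite (lt_le_trans _ (pi_s z))// lt_neqAle eq_sym piz pi0.
set r := 1 - _.
have r0 : 0 <= r.
  rewrite subr_ge0; apply: acceptance_prob_le1 (Q_density x) _ (ma x).
  exact: a_01.
have [C0_lt0|C0_ge0] := ltP C0 0.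
  rewrite (le_trans _ (poweR_ge0 _ _))// lee_fin C_def mulr_le0_ge0 ?powR_ge0//.
  rewrite mulr_le0_ge0 ?mulr_le0_ge0 ?(ltW C0_lt0)//.
  by rewrite invr_ge0 !mulr_ge0 ?powR_ge0.
have mx := measurable_set1_tuple x.
have stick : ((r ^+ t)%:E <= kernel_iter P t x [set x])%E.
  apply: kernel_iter_stick => //; apply: ARB_kernel_stick => //.
    by move=> y; case/andP: (a_01 x y).
  by have [] := Q_density x.
rewrite powRrM powR_mulrn//.
have M0 : 0 <= r ^+ t by exact: exprn_ge0.
set M := r ^+ t in M0 stick *.
pose h := (M / (s * (1 + d%:R))) `^ d%:R^-1 / 2.
have h0 : 0 <= h by rewrite divr_ge0 ?powR_ge0.
have [volh Ceq] := optimal_radius C0 d_gt0 s0 M0 (erefl h).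
rewrite C_def Ceq.
have hB : forall i : 'I_d, tnth x i - h <= tnth x i + h.
  by move=> i; rewrite lerD2l (le_trans _ h0)// oppr_le0.
pose B := [set y : d.-tuple R |
  forall i, tnth x i - h <= tnth y i <= tnth x i + h].
have mB : measurable B by exact: measurable_box.
have d1 : 0 < 1 + d%:R :> R by rewrite addr_gt0// ltr0n.
apply: (@le_wasserstein_escape _ _ _ c p _ _ [set x] B) => //.
- by rewrite mulr_ge0.
- by rewrite divr_ge0 ?mulr_ge0 ?(ltW d1).
- move=> _ y -> nBy; rewrite (le_trans _ (c_ge _ _))// ler_wpM2l//.
  exact: dist_l1_outside_box.
- apply: le_trans stick.
  have -> : M%:E = ((M * d%:R / (1 + d%:R))%:E + (M / (1 + d%:R))%:E)%E.
    by rewrite -EFinD; congr EFin; field; rewrite gt_eqF.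
  apply: leeD2l.
  have PiB : (Pi B <= s%:E * lebesgue_tuple d B)%E.
    exact: density_le_scale Pi_density pi_s mB.
  rewrite (le_trans PiB)// lebesgue_tuple_box//.
  rewrite (eq_bigr (fun=> h + h)); last by move=> i _; ring.
  by rewrite prodr_const card_ord -EFinM volh.
Qed.
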